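(* Let $0<q<1$, $x_0\in\mathbb{R}$, $0<t_1<t_2<\cdots<t_N<\infty$, and for $i=1,\dots,N$ let $g_i:\mathbb{R}\to\mathbb{R}$ be Lipschitz with constant $c_i$. Put $g(x)=\sum_{i=1}^N g_i(x(t_i))$ and $L_g=\sum_{i=1}^N c_i$. Let $f:\mathbb{R}_+\times\mathbb{R}\to\mathbb{R}$ be a continuous function. If there exists a positive constant $L_f$ such that $$|f(s,u)-f(s,v)|\le L_f|u-v|\quad\text{for all } u,v\in\mathbb{R}\text{ and a.e. } s\ge 0,$$ then the Volterra integral equation $$x(t)=x_0+g(x)+\frac{1}{\Gamma(q)}\int_0^t(t-s)^{q-1}f(s,x(s))\,ds,\qquad t\ge 0,$$ and therefore the equivalent Cauchy problem with nonlocal initial condition $${}^cD^q x(t)=f(t,x(t))\ \text{ in }\mathbb{R}_+,\qquad x(0)=x_0+g(x),$$ has a unique solution in $\mathcal{C}(\mathbb{R}_+)$ whenever $$\frac{L_f}{\Gamma(q)}\left(\frac{t_N^q}{q}\right)+L_g<1.$$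
   Context: $\mathbb{R}_+=[0,\infty)$, $\mathcal{C}(\mathbb{R}_+)$ is the set of continuous functions $\mathbb{R}_+\to\mathbb{R}$, and $\Gamma$ is the Gamma function. The Caputo fractional derivative of order $q\in(0,1)$ is ${}^cD^qx(t)=\frac{1}{\Gamma(1-q)}\int_0^t(t-s)^{-q}x'(s)\,ds$. Since $f$ is continuous, the Cauchy problem is regarded as equivalent to the Volterra integral equation: a function in $\mathcal{C}(\mathbb{R}_+)$ is a solution of the Cauchy problem if and only if it is a solution of the Volterra equation. The case in which $g$ is the null function is also allowed, with the convention $t_N=0$ (and $L_g=0$). *)

(* Defs.v *)
From HB Require Import structures.
From mathcomp Require Export all_boot all_order all_algebra.
From mathcomp Require Export all_classical all_reals all_analysis.
Export Order.TTheory GRing.Theory Num.Theory.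
Export numFieldNormedType.Exports.

Set Implicit Arguments.
Unset Strict Implicit.
Unset Printing Implicit Defensive.

Local Open Scope classical_set_scope.
Local Open Scope ring_scope.

(* Functions on R_+ = [0, +oo[ are represented by total functions on R of
   which only the values on [0, +oo[ matter. *)

Definition Gamma (R : realType) (a : R) : R :=
  \int[@lebesgue_measure R]_(s in `]0, +oo[) (s `^ (a - 1) * expR (- s)).

(* The integrand takes a junk value at the endpoint s = t only. *)
Definition caputo (R : realType) (q : R) (x : R -> R) (t : R) : R :=
  (Gamma (1 - q))^-1 *
  \int[@lebesgue_measure R]_(s in `[0, t]) ((t - s) `^ (- q) * derive1 x s).

Definition nonlocal (R : realType) (N : nat) (t : N.-tuple R)
    (g : 'I_N -> R -> R) (x : R -> R) : R :=
  \sum_(i < N) g i (x (tnth t i)).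

Definition continuous_Rplus (R : realType) (x : R -> R) : Prop :=
  {within `[0, +oo[, continuous x}.

Definition volterra_solution (R : realType) (q x0 : R) (G : (R -> R) -> R)
    (f : R -> R -> R) (x : R -> R) : Prop :=
  forall t : R, 0 <= t ->
    x t = x0 + G x + (Gamma q)^-1 *
      \int[@lebesgue_measure R]_(s in `[0, t]) ((t - s) `^ (q - 1) * f s (x s)).

(* The first two clauses say that the Caputo derivative of x exists at every
   t > 0, since derive1 and the integral are total operators.  The differential
   equation is required for t > 0 only: the integral defining the derivative is
   over a null set at t = 0. *)
Definition cauchy_solution (R : realType) (q x0 : R) (G : (R -> R) -> R)
    (f : R -> R -> R) (x : R -> R) : Prop :=
  [/\ forall t : R, 0 < t -> derivable x t 1,
      forall t : R, 0 < t ->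
        (@lebesgue_measure R).-integrable `[0, t]
          (fun s => ((t - s) `^ (- q) * derive1 x s)%:E),
      forall t : R, 0 < t -> caputo q x t = f t (x t)
    & x 0 = x0 + G x].

Definition unique_in_C_Rplus (R : realType) (P : (R -> R) -> Prop) : Prop :=
  exists x : R -> R, [/\ continuous_Rplus x, P x
    & forall y : R -> R, continuous_Rplus y -> P y ->
        forall t : R, 0 <= t -> y t = x t].

(* Main.v *)
Require Import Defs.
From mathcomp Require Import measurable_realfun ring lra.

(** The initial value and the integral equation can be decoupled.  Fix a real
    number [a] in place of [x0 + g x] and consider the ordinary Volterra
    equation [x t = a + kappa * abel q (f (., x)) t], with [kappa = 1 / Gamma q]
    and [abel] the convolution with the kernel [s |-> s ^ (q - 1)].  It has exactly
    one continuous solution [X a] on the whole half-line, without any smallness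
    condition ([volterra_op_fixed_exists], [volterra_op_fixed_unique]).
    Functions that solve the original equation are the [X a] for which
    [a = x0 + g (X a)], so that only a fixed point problem on the real line is
    left.  With [K = kappa * Lf * t_N ^ q / q], estimating the difference of two
    solutions at the point of [0, t_N] where it is largest gives
    [|X a - X b| <= |a - b| / (1 - K)] on that interval
    ([volterra_op_fixed_dep]).  All nodes of the nonlocal condition lie in
    [0, t_N], hence [a |-> x0 + g (X a)] is Lipschitz with constant
    [L_g / (1 - K)], which the smallness hypothesis makes less than 1; Banach's
    theorem on the real line concludes.

    Solvability for a fixed [a] comes from Picard iteration in the weighted
    distance [sup |x t - y t| * exp (- th * t)] over [0, T].  For [th] large,
    depending on [T], one iteration at least halves it ([volterra_op_half]),
    since convolution of the singular kernel with [exp (th * s)] is small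
    compared with [exp (th * t)] ([abel_weighted_small]).  The iterates are functions on the
    whole half-line which converge uniformly on every [0, T], so no gluing of
    local solutions is involved.

    All integral estimates come from one computation, the integral of the
    kernel over a subinterval ([integral_kernel]).  It also yields the Hoelder
    continuity of [abel q h] ([abel_holder]), by which the iteration stays
    among continuous functions. *)

Set Implicit Arguments.
Unset Strict Implicit.
Unset Printing Implicit Defensive.

Local Open Scope classical_set_scope.
Local Open Scope ring_scope.

(** * The integral of the kernel *)

Lemma is_derive_powR_sub (R : realType) (p t s : R) : s < t ->
  is_derive s 1 (fun s => (t - s) `^ p) (- (p * (t - s) `^ (p - 1))).
Proof.
move=> st; have ts0 : 0 < t - s by rewrite subr_gt0.
have := @is_derive1_comp R (fun y => y `^ p) (fun s => t - s) s
  (p * (t - s) `^ (p - 1)) (-1).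
rewrite mulrN1; apply; first exact: is_derive1_powR.
by have := @is_deriveB R R R (cst t) id s 1 0 1; rewrite sub0r; exact.
Qed.

Lemma continuous_powR_sub (R : realType) (p t s : R) : s < t ->
  {for s, continuous (fun s => (t - s) `^ p)}.
Proof.
move=> /(is_derive_powR_sub p)[d _].
exact/differentiable_continuous/derivable1_diffP.
Qed.

Lemma integral_kernel_lt (R : realType) (q a b t : R) :
  0 < q -> a <= b -> b < t ->
  (\int[@lebesgue_measure R]_(s in `[a, b]) ((t - s) `^ (q - 1))%:E =
   (((t - a) `^ q - (t - b) `^ q) / q)%:E)%E.
Proof.
move=> q0; rewrite le_eqVlt => /predU1P[<- _|ab bt].
  by rewrite set_itv1 integral_set1 subrr mul0r.
pose F s := (- q^-1) * (t - s) `^ q.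
have dF s : s < t -> is_derive s 1 F ((t - s) `^ (q - 1)).
  move=> st; have := @is_deriveZ R R R _ (- q^-1) _ 1 _ (is_derive_powR_sub q st).
  by rewrite scalerN scaleNr opprK /GRing.scale/= mulKf ?gt_eqF.
have cF s : s < t -> {for s, continuous F}.
  by move=> /dF[d _]; exact/differentiable_continuous/derivable1_diffP.
rewrite (@continuous_FTC2 R _ F a b)//.
- by rewrite -EFinB; congr EFin; rewrite /F; field; rewrite gt_eqF.
- apply: continuous_in_subspaceT => s; rewrite inE/= in_itv/= => /andP[_ sb].
  exact/continuous_powR_sub/(le_lt_trans sb).
- split.
  + move=> s; rewrite in_itv/= => /andP[_ sb].
    by have [] := dF s (lt_trans sb bt).
  + exact/cvg_at_right_filter/cF/(lt_trans ab).
  + exact/cvg_at_left_filter/cF.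
- move=> s; rewrite in_itv/= => /andP[_ sb].
  by have [_] := dF s (lt_trans sb bt); rewrite derive1E.
Qed.

Lemma measurable_kernel (R : realType) (p t : R) (A : set R) :
  measurable_fun A (fun s : R => (t - s) `^ p).
Proof.
apply: measurable_funTS; apply: (measurableT_comp (measurable_powR p)).
by apply: measurable_funB => //; exact: measurable_cst.
Qed.

(** Up to the singularity at [t] the integral is the limit of the integrals over
    the intervals ending at [t - (t - a) / n.+1], which exhaust [a, t). *)
Lemma integral_kernel (R : realType) (q a b t : R) :
  0 < q -> a <= b -> b <= t ->
  (\int[@lebesgue_measure R]_(s in `[a, b]) ((t - s) `^ (q - 1))%:E =
   (((t - a) `^ q - (t - b) `^ q) / q)%:E)%E.
Proof.
move=> q0 ab; rewrite le_eqVlt => /predU1P[bt|]; last exact: integral_kernel_lt.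
rewrite {b}bt in ab *.
have [->|at_] := eqVneq a t; first by rewrite set_itv1 integral_set1 subrr mul0r.
have {at_ ab} at_ : a < t by rewrite lt_neqAle at_.
pose b n : R := t - (t - a) / n.+1%:R.
have bt n : b n < t by rewrite gtrBl divr_gt0 ?subr_gt0.
have ab n : a <= b n.
  rewrite lerBrDr -lerBrDl ler_pdivrMr//.
  by apply: ler_peMr; rewrite ?ler1n// subr_ge0 ltW.
rewrite -integral_itv_bndo_bndc; last first.
  by apply/measurable_EFinP; exact: measurable_kernel.
have -> : `[a, t[%classic = \bigcup_n `[a, b n]%classic.
  apply/seteqP; split => [s|s [n _]]/=; rewrite !in_itv/= => /andP[as_ st];
    last first.
    by rewrite as_ (le_lt_trans st).
  have [n nP] : exists n, (t - a) / (t - s) < n%:R.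
    eexists; exact: truncnS_gt.
  exists n => //=; rewrite in_itv/= as_/= lerBrDr -lerBrDl.
  rewrite ler_pdivrMr// mulrC -ler_pdivrMr ?subr_gt0//.
  by rewrite (le_trans (ltW nP))// ler_nat.
have h : (\int[@lebesgue_measure R]_(s in `[a, b n])
    ((t - s) `^ (q - 1))%:E)%E @[n --> \oo] --> (((t - a) `^ q - (t - t) `^ q) / q)%:E.
  under eq_fun do rewrite integral_kernel_lt//.
  apply: cvg_EFin; first exact: nearW.
  apply: cvgMl; apply: cvgB; first exact: cvg_cst.
  rewrite subrr powR0 ?gt_eqF//.
  have /cvg_at_rightP/(_ (fun n => t - b n)) := powR_cvg0 q0.
  apply; split=> [n|]; first by rewrite subr_gt0.
  rewrite /b; under eq_fun do rewrite subKr.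
  rewrite -(mulr0 (t - a)); apply: cvgMr; exact: cvg_harmonic.
apply/esym; move/(cvg_lim (@ereal_hausdorff R)) : h => <-.
apply: cvg_lim => //; apply: ge0_nondecreasing_set_cvg_integral => //.
- move=> m n mn; rewrite subsetEset; apply: subset_itvl; rewrite bnd_simp.
  by rewrite lerD2l lerN2 ler_pM2l ?subr_gt0// lef_pV2 ?posrE// ler_nat.
- by move=> n; apply/measurable_EFinP; exact: measurable_kernel.
- by move=> n s _; rewrite lee_fin powR_ge0.
Qed.

(** * Continuous functions on the half-line *)

Lemma continuous_RplusP (R : realType) (x : R -> R) :
  continuous_Rplus x <->
  forall t : R, 0 <= t -> x @ within [set s : R | 0 <= s] (nbhs t) --> x t.
Proof.
have E : `[0 : R, +oo[%classic = [set s : R | 0 <= s].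
  by apply/seteqP; split=> s /=; rewrite in_itv/= andbT.
by rewrite /continuous_Rplus E; exact: subspace_continuousP.
Qed.

Lemma continuous_Rplus_itv (R : realType) (a b : R) (h : R -> R) : 0 <= a ->
  continuous_Rplus h -> {within `[a, b], continuous h}.
Proof.
move=> a0; apply: continuous_subspaceW => s /=.
by rewrite !in_itv/= andbT => /andP[+ _]; exact: le_trans.
Qed.

Lemma continuous_Rplus_bounded (R : realType) (h : R -> R) (T : R) :
  0 <= T -> continuous_Rplus h ->
  exists2 M, 0 < M & forall s, 0 <= s <= T -> `|h s| <= M.
Proof.
move=> T0 /(continuous_Rplus_itv (b := T) (lexx 0)) ch.
have [c _ hc] : exists2 c, c \in `[0, T]%R &
    forall t, t \in `[0, T]%R -> (fun s => `|h s|) t <= (fun s => `|h s|) c.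
  by apply: EVT_max => // s; apply: continuous_comp; [exact: ch|exact: norm_continuous].
exists (`|h c| + 1); first by rewrite ltr_wpDl.
by move=> s sT; rewrite (le_trans (hc s _)) ?lerDl// in_itv.
Qed.

Lemma cst_continuous_Rplus (R : realType) (a : R) :
  continuous_Rplus (fun _ : R => a).
Proof. by apply: continuous_subspaceT => ?; exact: cvg_cst. Qed.

Lemma continuous_RplusB (R : realType) (x y : R -> R) : continuous_Rplus x ->
  continuous_Rplus y -> continuous_Rplus (fun s => x s - y s).
Proof. by move=> cx cy s; apply: cvgB; [exact: cx|exact: cy]. Qed.

Lemma continuous_Rplus_comp2 (R : realType) (f : R -> R -> R) (x : R -> R) :
  {within [set z : R * R | 0 <= z.1], continuous (fun z : R * R => f z.1 z.2)} ->
  continuous_Rplus x -> continuous_Rplus (fun s => f s (x s)).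
Proof.
move=> /subspace_continuousP cf /continuous_RplusP cx.
apply/continuous_RplusP => t t0.
have := cf (t, x t) t0 => /= cft.
suff H : (fun s => (s, x s)) @ within [set s : R | 0 <= s] (nbhs t) -->
    within [set z : R * R | 0 <= z.1] (nbhs (t, x t)).
  exact: (cvg_comp _ _ H cft).
have xt := cx t t0.
have idt : id @ within [set s : R | 0 <= s] (nbhs t) --> t.
  by apply: cvg_within_filter; exact: cvg_id.
move=> A /(cvg_pair idt xt); rewrite !nbhs_simpl /=.
by rewrite /within/=; apply: filterS => s /= K s0; exact: K.
Qed.

(** The exceptional null set may depend on [u] and [v], but for fixed [u], [v]
    both sides are continuous in [s], so a violation at one point would persist
    on an interval of positive length. *)
Lemma ae_lipschitz_everywhere (R : realType) (f : R -> R -> R) (L : R) :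
  {within [set z : R * R | 0 <= z.1], continuous (fun z : R * R => f z.1 z.2)} ->
  (forall u v : R, {ae @lebesgue_measure R, forall s : R, 0 <= s ->
             `|f s u - f s v| <= L * `|u - v|}) ->
  forall s u v, 0 <= s -> `|f s u - f s v| <= L * `|u - v|.
Proof.
move=> cf fL s u v s0; rewrite leNgt; apply/negP => lt_f.
have cphi w : continuous_Rplus (fun t => f t w).
  by apply: (continuous_Rplus_comp2 (x := fun=> w) cf); exact: cst_continuous_Rplus.
have cd : (fun t => `|f t u - f t v|) @ within [set t | 0 <= t] (nbhs s) -->
    `|f s u - f s v|.
  by apply: cvg_norm; apply: cvgB; exact: (continuous_RplusP _).1.
have := @cvgr_gt _ _ _ _ _ _ cd _ lt_f; rewrite near_withinE.
move=> [d /= d0 hd].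
have : (@lebesgue_measure R).-negligible `]s, s + d[.
  apply: negligibleS (fL u v) => t /=; rewrite in_itv/= => /andP[st td].
  have t0 := le_trans s0 (ltW st).
  move=> /(_ t0); apply/negP; rewrite -ltNge; apply: hd => //=.
  by rewrite distrC ger0_norm ?subr_ge0 ?ltW// ltrBlDl.
move=> /negligibleP m0.
have := etrans (esym (lebesgue_measure_itv `]s, s + d[%R)) (m0 (measurable_itv _)).
rewrite /= lte_fin ltrDl d0 -EFinB => /eqP.
by rewrite eqe addrC addKr gt_eqF.
Qed.

(** * Convolution with the singular kernel *)

Section kernel.
Context {R : realType}.
Notation mu := (@lebesgue_measure R).
Implicit Types (q r a b t T M : R) (h : R -> R).

Lemma integrable_kernel q a b t : 0 < q -> a <= b -> b <= t ->
  mu.-integrable `[a, b] (EFin \o (fun s => (t - s) `^ (q - 1))).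
Proof.
move=> q0 ab bt; apply/integrableP; split.
  by apply/measurable_EFinP; exact: measurable_kernel.
under eq_integral do rewrite /= ger0_norm ?powR_ge0//.
by rewrite integral_kernel// ltry.
Qed.

Lemma Rintegral_kernel q a b t : 0 < q -> a <= b -> b <= t ->
  \int[mu]_(s in `[a, b]) ((t - s) `^ (q - 1)) =
  ((t - a) `^ q - (t - b) `^ q) / q.
Proof. by move=> q0 ab bt; rewrite /Rintegral integral_kernel. Qed.

Lemma integrable_kernelM q a b t h : 0 < q -> 0 <= a -> a <= b -> b <= t ->
  continuous_Rplus h ->
  mu.-integrable `[a, b] (EFin \o (fun s => (t - s) `^ (q - 1) * h s)).
Proof.
move=> q0 a0 ab bt ch.
have [M M0 hM] := continuous_Rplus_bounded (le_trans a0 ab) ch.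
have ik := integrable_kernel q0 ab bt.
apply: (le_integrable _ _ _ (integrableZl _ M ik)) => //.
  apply/measurable_EFinP/measurable_funM; first exact: measurable_kernel.
  apply: subspace_continuous_measurable_fun => //.
  exact: continuous_Rplus_itv.
move=> s; rewrite /= in_itv/= => /andP[as_ sb].
rewrite lee_fin !normrM (gtr0_norm M0) mulrC.
by rewrite ler_wpM2r// hM// sb andbT (le_trans a0).
Qed.

(** The majorant may carry an exponent [r] other than [q]: this lets part of the
    singularity be traded for the decay of an exponential weight. *)
Lemma norm_Rintegral_kernel_le q r a b t h (C : R) : 0 < q -> 0 < r ->
  0 <= a -> a <= b -> b <= t -> continuous_Rplus h ->
  (forall s, a <= s <= b ->
    (t - s) `^ (q - 1) * `|h s| <= C * (t - s) `^ (r - 1)) ->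
  `|\int[mu]_(s in `[a, b]) ((t - s) `^ (q - 1) * h s)| <=
  C * (((t - a) `^ r - (t - b) `^ r) / r).
Proof.
move=> q0 r0 a0 ab bt ch hC.
have ih := integrable_kernelM q0 a0 ab bt ch.
have ik := integrable_kernel r0 ab bt.
apply: (le_trans (le_normr_Rintegral _ ih)) => //.
rewrite -Rintegral_kernel// -RintegralZl//.
apply: le_Rintegral => //.
- exact: (integrable_norm ih).
- exact: (integrableZl _ C ik).
- by move=> s /=; rewrite in_itv/= normrM (ger0_norm (powR_ge0 _ _)); exact: hC.
Qed.

(** This is [Gamma q] times the Riemann-Liouville integral of order [q]. *)
Definition abel q h t := \int[mu]_(s in `[0, t]) ((t - s) `^ (q - 1) * h s).

Lemma abel_norm_le q h t M : 0 < q -> 0 <= t -> continuous_Rplus h ->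
  (forall s, 0 <= s <= t -> `|h s| <= M) -> `|abel q h t| <= M * (t `^ q / q).
Proof.
move=> q0 t0 ch hM.
have := @norm_Rintegral_kernel_le q q 0 t t h M q0 q0 (lexx 0) t0 (lexx t) ch.
rewrite subrr subr0 powR0 ?gt_eqF// subr0; apply=> s sab.
by rewrite mulrC ler_wpM2r ?powR_ge0// hM.
Qed.

Lemma abelB q h k t : 0 < q -> 0 <= t -> continuous_Rplus h ->
  continuous_Rplus k ->
  abel q h t - abel q k t = abel q (fun s => h s - k s) t.
Proof.
move=> q0 t0 ch ck; rewrite /abel -RintegralB//; first last.
- exact: integrable_kernelM.
- exact: integrable_kernelM.
by apply: eq_Rintegral => s _; rewrite mulrBr.
Qed.

(** The increment is the integral of the new kernel over [t, t'] minus that of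
    the decrease of the kernel over [0, t).  The kernel decreases in [t], so
    each part has a signed majorant whose integral is explicit, and each is at
    most [M * (t' - t) ^ q / q].  The right end point is left out of [0, t)
    because for [q < 1] the power [0 `^ (q - 1)] is 0 by convention, which breaks
    the monotonicity there. *)
Lemma abel_holder q h t t' M : 0 < q -> q <= 1 -> 0 <= t -> t <= t' ->
  continuous_Rplus h -> 0 <= M ->
  (forall s, 0 <= s <= t' -> `|h s| <= M) ->
  `|abel q h t' - abel q h t| <= 2 * M * ((t' - t) `^ q / q).
Proof.
move=> q0 q1 t0 tt' ch M0 hM; rewrite {1}/abel.
have t'0 := le_trans t0 tt'.
have ih' := integrable_kernelM q0 (lexx 0) t'0 (lexx t') ch.
have ih1 := integrable_kernelM q0 (lexx 0) t0 tt' ch.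
have ih := integrable_kernelM q0 (lexx 0) t0 (lexx t) ch.
have ik' := integrable_kernel q0 t0 tt'.
have ik := integrable_kernel q0 t0 (lexx t).
have subo (k : R -> R) : mu.-integrable `[0, t] (EFin \o k) ->
    mu.-integrable `[0, t[ (EFin \o k).
  by apply: integrableS => //; apply: subset_itvl; rewrite bnd_simp.
have -> : \int[mu]_(s in `[0, t']) ((t' - s) `^ (q - 1) * h s) - abel q h t =
    \int[mu]_(s in `[t, t']) ((t' - s) `^ (q - 1) * h s) -
    \int[mu]_(s in `[0, t[) (((t - s) `^ (q - 1) - (t' - s) `^ (q - 1)) * h s).
  have := @Rintegral_itvB R _ (BLeft 0) (BRight t') t ih'.
  rewrite !bnd_simp => /(_ t0 tt').
  rewrite Rintegral_itv_obnd_cbnd; last first.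
    by apply: integrableS ih' => //; apply: subset_itvr; rewrite bnd_simp.
  move=> <-.
  under [X in _ = _ - _ - X]eq_Rintegral do rewrite mulrBl.
  rewrite RintegralB//; [|exact: subo..].
  by rewrite !Rintegral_itv_bndo_bndc ?opprB ?addrA ?subrK//; exact: subo.
rewrite (le_trans (ler_normB _ _))//.
have -> : 2 * M * ((t' - t) `^ q / q) =
   M * ((t' - t) `^ q / q) + M * ((t' - t) `^ q / q) by ring.
apply: lerD.
  have := @norm_Rintegral_kernel_le q q t t' t' h M q0 q0 t0 tt' (lexx t') ch.
  rewrite subrr powR0 ?gt_eqF// subr0; apply => s /andP[ts st'].
  by rewrite mulrC ler_wpM2r ?powR_ge0// hM// st' andbT (le_trans t0).
have kk s : 0 <= s < t -> (t' - s) `^ (q - 1) <= (t - s) `^ (q - 1).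
  move=> /andP[_ st].
  have ts0 : 0 < t - s by rewrite subr_gt0.
  have ts'0 : 0 < t' - s by rewrite subr_gt0 (lt_le_trans st).
  rewrite -(opprB 1 q) !powRN lef_pV2 ?posrE ?powR_gt0//.
  by rewrite ge0_ler_powR ?nnegrE ?subr_ge0 ?lerD2r// ltW// -subr_gt0.
have iB : mu.-integrable `[0, t[
    (EFin \o (fun s => (t - s) `^ (q - 1) - (t' - s) `^ (q - 1))).
  by apply: subo; exact: (integrableB _ ik ik').
have iBh : mu.-integrable `[0, t[
    (EFin \o (fun s => ((t - s) `^ (q - 1) - (t' - s) `^ (q - 1)) * h s)).
  apply: subo; apply: eq_integrable; last exact: (integrableB _ ih ih1).
    by [].
  move=> s _ /=.
  by rewrite -EFinB mulrBl.
apply: (le_trans (le_normr_Rintegral _ iBh)) => //.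
apply: (@le_trans _ _ (\int[mu]_(s in `[0, t[)
    (M * ((t - s) `^ (q - 1) - (t' - s) `^ (q - 1))))).
  apply: le_Rintegral => //.
  - exact: (integrable_norm iBh).
  - exact: (integrableZl _ M iB).
  - move=> s /=; rewrite in_itv/= => st.
    rewrite normrM ger0_norm ?subr_ge0 ?kk// mulrC ler_wpM2r ?subr_ge0 ?kk//.
    by case/andP: st => s0 st; rewrite hM// s0 (le_trans (ltW st)).
rewrite RintegralZl// ler_wpM2l//.
rewrite RintegralB//; [|exact: subo..].
rewrite !Rintegral_itv_bndo_bndc ?Rintegral_kernel//; [|exact: subo..].
rewrite subrr !subr0 powR0 ?gt_eqF// subr0 -mulrBl ler_wpM2r ?invr_ge0 ?(ltW q0)//.
have : t `^ q <= t' `^ q by rewrite ge0_ler_powR ?nnegrE// ltW.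
by lra.
Qed.

Lemma expR_le_powR (u r : R) : 0 < u -> 0 < r -> r <= 1 ->
  expR (- u) <= u `^ (- r).
Proof.
move=> u0 r0 r1; rewrite expRN powRN lef_pV2 ?posrE ?expR_gt0 ?powR_gt0//.
have [u1|u1] := leP 1 u.
  apply: (@le_trans _ _ u); first by rewrite ler1_powR.
  by rewrite (le_trans _ (expR_ge1Dx u))// lerDr.
apply: (@le_trans _ _ 1); last by rewrite -expR0 ler_expR ltW.
by rewrite -[leRHS](powRr0 u) ger_powR ?u0 ?ltW//.
Qed.

(** Dividing by the weight at [t] leaves the kernel [u ^ (q - 1) * exp (- th * u)]
    in [u = t - s].  With [r = q / 2], the bound [exp (- v) <= v ^ (- r)] turns it
    into [th ^ (- r) * u ^ (r - 1)], which is integrable and small when [th] is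
    large. *)
Lemma abel_weighted_small q T (e : R) : 0 < q -> q < 1 -> 0 <= T -> 0 < e ->
  exists2 th : R, 0 <= th & forall h D t, continuous_Rplus h -> 0 <= t <= T ->
    0 <= D ->
    (forall s, 0 <= s <= t -> `|h s| <= D * expR (th * s)) ->
    `|abel q h t| <= e * D * expR (th * t).
Proof.
move=> q0 q1 T0 e0.
have [r r0 qr] : exists2 r, 0 < r & q = r + r by exists (q / 2); lra.
have r1 : r <= 1 by lra.
have re0 : 0 < r * e by rewrite mulr_gt0.
have T1 : 0 < T + 1 by rewrite ltr_wpDl.
have [th th0 thE] : exists2 th : R, 0 < th & th `^ r * (r * e) = (T + 1) `^ r.
  exists ((T + 1) * (r * e) `^ (- r^-1)); first by rewrite mulr_gt0 ?powR_gt0.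
  rewrite powRM ?powR_ge0 ?(ltW T1)// -powRrM mulNr mulVf ?gt_eqF//.
  by rewrite powRN powRr1 ?(ltW re0)// mulfVK ?gt_eqF.
exists th; first exact: ltW.
move=> h D t ch /andP[t0 tT] D0 hD.
have := @norm_Rintegral_kernel_le q r 0 t t h
  (D * expR (th * t) * th `^ (- r)) q0 r0 (lexx 0) t0 (lexx t) ch.
rewrite subrr subr0 powR0 ?gt_eqF// subr0 => H.
apply: (le_trans (H _)) => [s /andP[s0 st]|{H}].
  (* at [s = t] the kernel takes its conventional value 0 *)
  move: (st); rewrite le_eqVlt => /predU1P[->|st'].
    rewrite subrr powR0 ?subr_eq0 ?lt_eqF//.
    by rewrite mul0r !mulr_ge0// ?expR_ge0 ?powR_ge0.
  have ts0 : 0 < t - s by rewrite subr_gt0.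
  have hs : `|h s| <= D * expR (th * t) * (th * (t - s)) `^ (- r).
    rewrite (le_trans (hD _ _)) ?s0// -mulrA ler_wpM2l//.
    have -> : th * s = th * t - th * (t - s) by ring.
    by rewrite expRD ler_wpM2l ?expR_ge0// expR_le_powR// mulr_gt0.
  rewrite mulrC (le_trans (ler_wpM2r (powR_ge0 _ _) hs))//.
  rewrite powRM ?(ltW th0) ?(ltW ts0)// -!mulrA -powRD; last first.
    by apply/implyP => _; rewrite gt_eqF.
  by have -> : - r + (q - 1) = r - 1 by lra.
have -> : e * D * expR (th * t) = D * expR (th * t) * e by ring.
rewrite -[leLHS]mulrA ler_wpM2l ?mulr_ge0 ?expR_ge0//.
rewrite powRN mulrA ler_pdivrMr// mulrC ler_pdivrMr ?powR_gt0//.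
rewrite mulrC (mulrC e) thE ge0_ler_powR ?nnegrE ?(ltW r0) ?(ltW T1)//.
by rewrite (le_trans tT)// lerDl.
Qed.

Lemma continuous_abel q h : 0 < q -> q <= 1 -> continuous_Rplus h ->
  continuous_Rplus (abel q h).
Proof.
move=> q0 q1 ch; apply/continuous_RplusP => t t0.
have [M M0 hM] := continuous_Rplus_bounded (addr_ge0 t0 ler01) ch.
apply/cvgrPdist_lt => e e0.
have eM : 0 < e * q / (2 * M) by rewrite divr_gt0 ?mulr_gt0.
(* the radius solves [2 * M * (d ^ q / q) = e] *)
have d0 : 0 < (e * q / (2 * M)) `^ q^-1 by rewrite powR_gt0.
rewrite near_withinE; exists (Num.min 1 ((e * q / (2 * M)) `^ q^-1)).
  by rewrite /= lt_min ltr01.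
move=> s /=; rewrite lt_min => /andP[ts1 ts] s0.
have s1 : s <= t + 1.
  by rewrite -lerBlDl (le_trans (ler_norm _))// distrC ltW.
have H : 2 * M * (`|t - s| `^ q / q) < e.
  rewrite mulrA ltr_pdivrMr// mulrC -ltr_pdivlMr ?mulr_gt0//.
  have {1}-> : e * q / (2 * M) = ((e * q / (2 * M)) `^ q^-1) `^ q.
    by rewrite -powRrM mulVf ?gt_eqF// powRr1 ?(ltW eM).
  by rewrite gt0_ltr_powR ?nnegrE ?powR_ge0.
apply: le_lt_trans H; have [st|ts'] := leP s t.
  rewrite (@ger0_norm _ (t - s)) ?subr_ge0//.
  apply: abel_holder; rewrite ?(ltW M0)// => u /andP[u0 ut].
  by rewrite hM// u0 (le_trans ut) ?lerDl.
rewrite distrC (distrC t s) (@ger0_norm _ (s - t)) ?subr_ge0 ?(ltW ts')//.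
apply: abel_holder; rewrite ?(ltW ts') ?(ltW M0)// => u /andP[u0 us].
by rewrite hM// u0 (le_trans us).
Qed.

End kernel.

(** * Sequences with geometrically small increments *)

Lemma cvg_div_exp2 (R : realType) (B : R) :
  (fun n => B / 2 ^+ n) @ \oo --> (0 : R).
Proof.
have -> : (fun n => B / 2 ^+ n) = geometric B 2^-1.
  by apply/funext => n; rewrite /geometric/= exprVn.
by apply: cvg_geometric; rewrite ger0_norm// invf_lt1// ltr1n.
Qed.

(** Adding or subtracting the geometric tail [2 * B / 2 ^ n] makes the sequence
    nonincreasing or nondecreasing, so that the limit exists by monotonicity and
    lies between the two at every index. *)
Lemma geometric_cauchy (R : realType) (B : R) (u : R^nat) :
  (forall n, `|u n.+1 - u n| <= B / 2 ^+ n) ->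
  cvgn u /\ forall n, `|limn u - u n| <= 2 * B / 2 ^+ n.
Proof.
move=> uB.
have B0 : 0 <= B by have := uB 0; rewrite expr0 divr1; exact: le_trans.
pose v n := u n + 2 * B / 2 ^+ n; pose w n := u n - 2 * B / 2 ^+ n.
have E n : 2 * B / 2 ^+ n = 2 * B / 2 ^+ n.+1 + B / 2 ^+ n.
  by rewrite exprS; field; rewrite expf_neq0.
have g0 := cvg_div_exp2 (2 * B).
have vd : nonincreasing_seq v.
  apply/nonincreasing_seqP => n; rewrite /v (E n).
  have := uB n; rewrite ler_norml => /andP[_]; lra.
have wi : nondecreasing_seq w.
  apply/nondecreasing_seqP => n; rewrite /w (E n).
  have := uB n; rewrite ler_norml => /andP[+ _]; lra.
have cv : cvgn v.
  apply: nonincreasing_is_cvgn => //; exists (w 0) => _ [n _ <-].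
  apply: (le_trans (wi 0 n (leq0n n))); rewrite /w /v lerD2l.
  have : 0 <= 2 * B / 2 ^+ n by rewrite divr_ge0 ?exprn_ge0// mulr_ge0.
  lra.
have uv : u @ \oo --> limn v.
  rewrite -[limn v]subr0; have -> : u = (fun n => v n - 2 * B / 2 ^+ n).
    by apply/funext => n; rewrite /v addrK.
  exact: cvgB.
have cu : cvgn u by apply/cvg_ex; exists (limn v).
have luv : limn u = limn v by apply/cvg_lim.
have wl : w @ \oo --> limn u.
  by rewrite -[limn u]subr0; apply: cvgB.
split=> // n; rewrite ler_norml; apply/andP; split.
  have := nondecreasing_cvgn_le wi (cvgP _ wl) n.
  by rewrite (cvg_lim _ wl)// /w; lra.
by have := nonincreasing_cvgn_ge vd cv n; rewrite -luv /v; lra.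
Qed.

Lemma geometric_half_lt (R : realType) (B e : R) : 0 < e ->
  exists n, B / 2 ^+ n < e.
Proof.
move=> e0; have /cvgr_lt/(_ _ e0)[n _ /(_ n (leqnn n))] := cvg_div_exp2 B.
by exists n.
Qed.

Lemma le_geometric_eq0 (R : realType) (x B : R) :
  (forall n, `|x| <= B / 2 ^+ n) -> x = 0.
Proof.
move=> xB; apply/eqP; rewrite -normr_le0; apply/ler_addgt0Pl => e e0.
have [n /ltW Bn] := geometric_half_lt B e0.
by rewrite addr0 (le_trans (xB n)).
Qed.

(** * The Volterra equation with a prescribed constant term *)

Section volterra.
Context {R : realType}.
Variables (q kappa L : R) (F : R -> R -> R).
Hypotheses (q0 : 0 < q) (q1 : q < 1) (kappa0 : 0 <= kappa) (L0 : 0 <= L).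
Hypothesis cF : forall x, continuous_Rplus x ->
  continuous_Rplus (fun s => F s (x s)).
Hypothesis lipF : forall s u v, 0 <= s -> `|F s u - F s v| <= L * `|u - v|.
Implicit Types (x y : R -> R) (a b t T D M : R).

Definition volterra_op a x t := a + kappa * abel q (fun s => F s (x s)) t.

Lemma continuous_volterra_op a x :
  continuous_Rplus x -> continuous_Rplus (volterra_op a x).
Proof.
move=> /cF /(continuous_abel q0 (ltW q1)) cx s.
by apply: cvgD; [exact: cvg_cst|apply: cvgMr; exact: cx].
Qed.

Lemma volterra_opB a b x y t : 0 <= t ->
  continuous_Rplus x -> continuous_Rplus y ->
  volterra_op a x t - volterra_op b y t =
  (a - b) + kappa * abel q (fun s => F s (x s) - F s (y s)) t.
Proof.
by move=> t0 /cF cx /cF cy; rewrite -abelB// /volterra_op; ring.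
Qed.

Lemma volterra_op_lipschitz a b x y t M : 0 <= t ->
  continuous_Rplus x -> continuous_Rplus y ->
  (forall s, 0 <= s <= t -> `|x s - y s| <= M) ->
  `|volterra_op a x t - volterra_op b y t| <=
    `|a - b| + kappa * L * (t `^ q / q) * M.
Proof.
move=> t0 cx cy xyM; rewrite volterra_opB//.
rewrite (le_trans (ler_normD _ _))// lerD2l normrM ger0_norm//.
have -> : kappa * L * (t `^ q / q) * M = kappa * (L * M * (t `^ q / q)) by ring.
rewrite ler_wpM2l//.
apply: abel_norm_le => //; first by apply: continuous_RplusB; exact: cF.
move=> s /andP[s0 st].
by rewrite (le_trans (lipF _ _ s0))// ler_wpM2l// xyM// s0.
Qed.

(** The rate [th] depends on [T] but not on the constant term, the functions or
    their distance [D], so the estimate can be iterated. *)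
Lemma volterra_op_half T : 0 <= T ->
  exists2 th, 0 <= th & forall a x y D t, 0 <= t <= T -> 0 <= D ->
    continuous_Rplus x -> continuous_Rplus y ->
    (forall s, 0 <= s <= t -> `|x s - y s| <= D * expR (th * s)) ->
    `|volterra_op a x t - volterra_op a y t| <= D / 2 * expR (th * t).
Proof.
move=> T0; pose e := (2 * (kappa * L + 1))^-1.
have kL : 0 < kappa * L + 1 by rewrite ltr_wpDl// mulr_ge0.
have e0 : 0 < e by rewrite invr_gt0 mulr_gt0.
have [th th0 H] := abel_weighted_small q0 q1 T0 e0.
exists th => // a x y D t tT D0 cx cy xyD; have /andP[t0 _] := tT.
rewrite volterra_opB// subrr add0r normrM (ger0_norm kappa0).
have := H _ (L * D) t (continuous_RplusB (cF cx) (cF cy)) tT (mulr_ge0 L0 D0).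
move=> /(_ _)/(ler_wpM2l kappa0)/le_trans; apply.
  move=> s /andP[s0 st]; rewrite (le_trans (lipF _ _ s0))// -mulrA.
  by rewrite ler_wpM2l// xyD// s0.
rewrite [leLHS]mulrA ler_wpM2r ?expR_ge0//.
have -> : kappa * (e * (L * D)) = (kappa * L) / (kappa * L + 1) * (D / 2).
  by rewrite /e; field; rewrite gt_eqF.
by rewrite ler_piMl ?divr_ge0// ler_pdivrMr// mul1r lerDl.
Qed.

(** One application of the operator halves the weighted distance of two fixed
    points, yet leaves them unchanged. *)
Lemma volterra_op_fixed_unique a x y :
  continuous_Rplus x -> continuous_Rplus y ->
  (forall t, 0 <= t -> x t = volterra_op a x t) ->
  (forall t, 0 <= t -> y t = volterra_op a y t) ->
  forall t, 0 <= t -> x t = y t.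
Proof.
move=> cx cy ex ey T T0.
have cxy : continuous_Rplus (fun s => x s - y s).
  exact: continuous_RplusB.
have [M M0 xyM] := continuous_Rplus_bounded T0 cxy.
have [th th0 H] := volterra_op_half T0.
have xyn n t : 0 <= t <= T -> `|x t - y t| <= M / 2 ^+ n * expR (th * t).
  elim: n t => [|n IH] t /andP[t0 tT].
    rewrite expr0 divr1 (le_trans (xyM _ _)) ?t0// ler_peMr ?(ltW M0)//.
    by rewrite -expR0 ler_expR mulr_ge0.
  rewrite ex// ey// exprSr invfM mulrA; apply: H => //; first by rewrite t0.
    by rewrite divr_ge0 ?exprn_ge0// ltW.
  by move=> s /andP[s0 st]; rewrite IH// s0 (le_trans st).
apply/eqP; rewrite -subr_eq0; apply/eqP.
apply: (@le_geometric_eq0 _ _ (M * expR (th * T))) => n.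
by rewrite mulrAC xyn// T0 lexx.
Qed.

(** At the point of [0, T] where the difference is largest, with value [M], the
    equations give [M <= |a - b| + K * M], where [K = kappa * L * T ^ q / q]. *)
Lemma volterra_op_fixed_dep a b x y T : 0 <= T ->
  kappa * L * (T `^ q / q) < 1 ->
  continuous_Rplus x -> continuous_Rplus y ->
  (forall t, 0 <= t -> x t = volterra_op a x t) ->
  (forall t, 0 <= t -> y t = volterra_op b y t) ->
  forall t, 0 <= t <= T ->
    `|x t - y t| <= `|a - b| / (1 - kappa * L * (T `^ q / q)).
Proof.
move=> T0 K1 cx cy ex ey.
have [|c cT maxc] := @EVT_max R (fun t => `|x t - y t|) 0 T T0.
  move=> s; apply: cvg_norm.
  by apply: cvgB; apply: continuous_Rplus_itv.
move: cT; rewrite in_itv/= => /andP[c0 cT].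
move=> t tT; rewrite (le_trans (maxc t _)) ?in_itv//=.
rewrite ler_pdivlMr ?subr_gt0// mulrBr mulr1 lerBlDr.
rewrite {1}(ex c c0) {1}(ey c c0).
apply: (le_trans (volterra_op_lipschitz _ _ c0 cx cy (M := `|x c - y c|) _)).
  by move=> s /andP[s0 sc]; apply: maxc; rewrite in_itv/= s0 (le_trans sc).
rewrite lerD2l [leRHS]mulrC ler_wpM2r// ler_wpM2l ?mulr_ge0//.
by rewrite ler_wpM2r ?invr_ge0 ?(ltW q0)// ge0_ler_powR ?nnegrE ?(ltW q0).
Qed.

(** The Picard iterates have geometrically small increments, uniformly on every
    [0, T].  Their pointwise limit is therefore continuous, and the Lipschitz
    estimate for the operator carries the equation to the limit. *)
Lemma volterra_op_fixed_exists a : exists2 x,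
  continuous_Rplus x & forall t, 0 <= t -> x t = volterra_op a x t.
Proof.
pose u n : R -> R := iter n (volterra_op a) (fun=> a).
have cu n : continuous_Rplus (u n).
  elim: n => [|n IH]; first exact: cst_continuous_Rplus.
  exact: continuous_volterra_op.
have uB T : 0 <= T -> exists2 B, 0 <= B & forall n t, 0 <= t <= T ->
    `|u n.+1 t - u n t| <= B / 2 ^+ n.
  move=> T0.
  have cu10 : continuous_Rplus (fun s => u 1%N s - u 0 s).
    exact: continuous_RplusB.
  have [M M0 uM] := continuous_Rplus_bounded T0 cu10.
  have [th th0 H] := volterra_op_half T0.
  have un n t : 0 <= t <= T ->
      `|u n.+1 t - u n t| <= M / 2 ^+ n * expR (th * t).
    elim: n t => [|n IH] t /andP[t0 tT].
      rewrite expr0 divr1 (le_trans (uM _ _)) ?t0// ler_peMr ?(ltW M0)//.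
      by rewrite -expR0 ler_expR mulr_ge0.
    rewrite exprSr invfM mulrA.
    apply: (H a (u n.+1) (u n)); rewrite ?t0 ?divr_ge0 ?exprn_ge0 ?(ltW M0)//.
    by move=> s /andP[s0 st]; rewrite IH// s0 (le_trans st).
  exists (M * expR (th * T)); first by rewrite mulr_ge0 ?expR_ge0 ?ltW.
  move=> n t tT; have /andP[t0 tleT] := tT.
  rewrite mulrAC (le_trans (un n t tT))// ler_wpM2l ?divr_ge0 ?exprn_ge0 ?(ltW M0)//.
  by rewrite ler_expR ler_wpM2l.
pose x t := limn (fun n => u n t).
have xu T : 0 <= T -> exists2 B, 0 <= B & forall n t, 0 <= t <= T ->
    `|x t - u n t| <= B / 2 ^+ n.
  move=> /uB[B B0 H]; exists (2 * B); first by rewrite mulr_ge0.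
  by move=> n t tT; apply: (geometric_cauchy _).2 => m; exact: H.
have cx : continuous_Rplus x.
  apply/continuous_RplusP => t t0; apply/cvgrPdist_lt => e e0.
  have [B B0 H] := xu (t + 1) (addr_ge0 t0 ler01).
  have [n Bn] : exists n, B / 2 ^+ n < e / 3.
    by apply: geometric_half_lt; rewrite divr_gt0.
  have /continuous_RplusP/(_ t t0)/cvgrPdist_lt/(_ (e / 3)) := cu n.
  rewrite divr_gt0// => /(_ isT); rewrite !near_withinE => -[d /= d0 hd].
  exists (Num.min 1 d); first by rewrite /= lt_min ltr01.
  move=> s /=; rewrite lt_min => /andP[ts1 ts] s0.
  have s1 : s <= t + 1.
    by rewrite -lerBlDl (le_trans (ler_norm _))// distrC ltW.
  have /= h1 := hd s ts s0.
  have h2 := le_lt_trans (H n t _) Bn; have h3 := le_lt_trans (H n s _) Bn.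
  have -> : x t - x s = (x t - u n t) + ((u n t - u n s) + - (x s - u n s)) by ring.
  rewrite (le_lt_trans (ler_normD _ _))//.
  have -> : e = e / 3 + (e / 3 + e / 3) by field.
  apply: ltrD; first by apply: h2; rewrite t0/= lerDl.
  rewrite (le_lt_trans (ler_normD _ _))// normrN.
  by apply: ltrD => //; apply: h3; rewrite s0.
exists x => // t t0; apply/eqP; rewrite -subr_eq0; apply/eqP.
have [B B0 H] := xu t t0.
pose K := kappa * L * (t `^ q / q).
have K0 : 0 <= K by rewrite !mulr_ge0 ?invr_ge0 ?powR_ge0// ltW.
apply: (@le_geometric_eq0 _ _ (B + K * B)) => n.
have -> : x t - volterra_op a x t =
    (x t - u n.+1 t) + (volterra_op a (u n) t - volterra_op a x t).
  by rewrite addrA subrK.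
rewrite (le_trans (ler_normD _ _))// mulrDl lerD//.
  rewrite (le_trans (H n.+1 t _)) ?t0 ?lexx//.
  by rewrite ler_wpM2l// lef_pV2 ?posrE ?exprn_gt0// ler_eXn2l ?ltr1n.
rewrite -mulrA -[leRHS]add0r -(normr0 R) -[in leRHS](subrr a).
apply: volterra_op_lipschitz => // s /andP[s0 st].
by rewrite distrC H// s0.
Qed.

End volterra.

(** * The nonlocal condition *)

Lemma Gamma_ge0 (R : realType) (a : R) : 0 <= Gamma a.
Proof. by apply: Rintegral_ge0 => s _; rewrite mulr_ge0 ?powR_ge0 ?expR_ge0. Qed.

Lemma path_lt_last (R : realType) (a : R) (s : seq R) : path <%R a s ->
  a <= last a s /\ forall x, x \in s -> a <= x <= last a s.
Proof.
elim: s a => [|b s IH] a /=; first by rewrite lexx.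
move=> /andP[ab /IH[bl sl]]; have al := le_trans (ltW ab) bl.
split=> // x; rewrite inE => /predU1P[->|/sl/andP[bx ->]]; first by rewrite bl ltW.
by rewrite andbT (le_trans (ltW ab)).
Qed.

Lemma lipschitz_const_ge0 (R : realType) (c : R) (g : R -> R) :
  c.-lipschitz g -> 0 <= c.
Proof.
move=> /(_ (1, 0) (conj I I))/=; rewrite subr0 normr1 mulr1.
exact: le_trans.
Qed.

Lemma nonlocal_lipschitz (R : realType) (N : nat) (t : N.-tuple R)
    (g : 'I_N -> R -> R) (c : 'I_N -> R) (x y : R -> R) (M : R) :
  (forall i, (c i).-lipschitz (g i)) ->
  (forall i, `|x (tnth t i) - y (tnth t i)| <= M) ->
  `|nonlocal t g x - nonlocal t g y| <= (\sum_(i < N) c i) * M.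
Proof.
move=> hg hM; rewrite /nonlocal -sumrB (le_trans (ler_norm_sum _ _ _))//.
rewrite mulr_suml ler_sum// => i _.
apply: (le_trans (hg i (x (tnth t i), y (tnth t i)) (conj I I))) => /=.
by rewrite ler_wpM2l ?hM//; exact: lipschitz_const_ge0 (hg i).
Qed.

(* [path <%R 0 t] says 0 < t_1 < ... < t_N, and [last 0 t] is t_N; the case
   N = 0 is that of the null g, where [last 0 t] = 0.  The equivalence of the
   two problems, a convention of the source, is a premise of the claim on the
   Cauchy problem only. *)
Theorem theorem5p1 (R : realType) (q x0 : R) (hq0 : 0 < q) (hq1 : q < 1)
    (N : nat) (t : N.-tuple R) (ht : path <%R 0 t)
    (g : 'I_N -> R -> R) (c : 'I_N -> R)
    (hg : forall i : 'I_N, (c i).-lipschitz (g i))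
    (f : R -> R -> R)
    (hf : {within [set z : R * R | 0 <= z.1],
             continuous (fun z : R * R => f z.1 z.2)})
    (Lf : R) (hLf : 0 < Lf)
    (hfL : forall u v : R, {ae @lebesgue_measure R, forall s : R, 0 <= s ->
             `|f s u - f s v| <= Lf * `|u - v|})
    (hsmall : Lf / Gamma q * (last 0 t `^ q / q) + \sum_(i < N) c i < 1) :
  unique_in_C_Rplus (volterra_solution q x0 (nonlocal t g) f) /\
  ((forall x : R -> R, continuous_Rplus x ->
      (cauchy_solution q x0 (nonlocal t g) f x <->
       volterra_solution q x0 (nonlocal t g) f x)) ->
   unique_in_C_Rplus (cauchy_solution q x0 (nonlocal t g) f)).
Proof.
have [T0 tT] := path_lt_last ht.
have kappa0 : 0 <= (Gamma q)^-1 by rewrite invr_ge0 Gamma_ge0.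
have lipF s u v := ae_lipschitz_everywhere hf hfL u v (s := s).
have cF x := continuous_Rplus_comp2 (x := x) hf.
have C0 : 0 <= \sum_(i < N) c i.
  by rewrite sumr_ge0// => i _; exact: lipschitz_const_ge0 (hg i).
set C := \sum_(i < N) c i in hsmall C0.
pose K := (Gamma q)^-1 * Lf * (last 0 t `^ q / q).
have KC : K + C < 1 by rewrite /K (mulrC _ Lf).
have K1 : 0 < 1 - K by lra.
have G_dep a b x y : continuous_Rplus x -> continuous_Rplus y ->
    (forall s, 0 <= s -> x s = volterra_op q (Gamma q)^-1 f a x s) ->
    (forall s, 0 <= s -> y s = volterra_op q (Gamma q)^-1 f b y s) ->
    `|nonlocal t g x - nonlocal t g y| <= C / (1 - K) * `|a - b|.
  move=> cx cy ex ey; rewrite -mulrA (mulrC _^-1).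
  apply: nonlocal_lipschitz => // i.
  apply: (volterra_op_fixed_dep hq0 kappa0 (ltW hLf) cF lipF T0) => //.
    by rewrite -/K; lra.
  by apply: tT; exact: mem_tnth.
have ratio1 : C / (1 - K) < 1 by rewrite ltr_pdivrMr// mul1r; lra.
have ratio0 : 0 <= C / (1 - K) by rewrite divr_ge0// ltW.
have volterra : unique_in_C_Rplus (volterra_solution q x0 (nonlocal t g) f).
  have [X HX] := choice (fun a =>
    let: ex_intro2 x cx ex :=
      volterra_op_fixed_exists hq0 hq1 kappa0 (ltW hLf) cF lipF a in
    ex_intro (fun x => continuous_Rplus x /\ forall s, 0 <= s ->
      x s = volterra_op q (Gamma q)^-1 f a x s) x (conj cx ex)).
  pose phi a := x0 + nonlocal t g (X a).
  have [p _ pE] : exists2 p, setT p & p = phi p.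
    apply: (@banach_fixed_point R R^o setT (totalfun phi)) => //.
      exists (NngNum ratio0); split=> //= -[a b] _ /=.
      rewrite /phi opprD addrACA subrr add0r.
      by apply: G_dep; case: (HX a); case: (HX b).
    by exists 0.
  have [cX eX] := HX p.
  exists (X p); split=> // [s s0|y cy ey s s0].
    by rewrite {1}eX// /volterra_op {1}pE.
  (* both constant terms are values of the nonlocal condition at the solutions,
     so their distance would be at most [C / (1 - K) < 1] times itself *)
  have py : p = x0 + nonlocal t g y.
    apply/eqP; rewrite -subr_eq0 -normr_le0 leNgt; apply/negP => d0.
    have := G_dep p (x0 + nonlocal t g y) _ _ cX cy eX ey.
    have -> : nonlocal t g (X p) - nonlocal t g y =
        p - (x0 + nonlocal t g y) by rewrite {2}pE /phi; ring.
    by rewrite leNgt gtr_pMl// ratio1.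
  apply: (volterra_op_fixed_unique hq0 hq1 kappa0 (ltW hLf) cF lipF cy cX _ eX s0).
  by rewrite py.
split=> // equiv; have [x [cx ex ux]] := volterra.
exists x; split=> //; first exact/equiv.
by move=> y cy /(equiv y cy); exact: ux.
Qed.
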